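(* Let $N=2^n$, let $|\psi\rangle=\sum_{j=0}^{N-1}x_j|j\rangle$, and let $F=\{a_k\}_{k=-d}^{d}$ be a filter. Then the convolution $$|\psi*F\rangle=\sum_{m=0}^{N-1}(\psi*F)_m|m\rangle,\qquad (\psi*F)_m=\sum_{k=-d}^{d}a_k\,x_{[m-k \bmod N]},$$ can be implemented (up to normalization, as a block of a unitary circuit with one ancilla qubit applied to $|\psi\rangle$) using only $\mathcal{O}(d\log N+\log^2N)$ 1- and 2-qubit gates.
   Context: $|j\rangle$ denotes computational basis states on $n$ qubits. Gates are arbitrary 1- and 2-qubit unitaries. *)

(* Defs.v *)
From HB Require Import structures.
From mathcomp Require Import all_boot all_order all_algebra.
From mathcomp Require Import complex reals.
Set Implicit Arguments. Unset Strict Implicit. Unset Printing Implicit Defensive.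
Import Order.TTheory GRing.Theory Num.Theory.
Local Open Scope ring_scope.

(* Qubit q of the computational-basis index i (little-endian: qubit q is the
   bit of weight 2^q). *)
Definition bitq (q i : nat) : bool := odd (i %/ 2 ^ q).

Section Circuits.
Variable R : realType.
Local Notation C := R[i].

Inductive gate (m : nat) : Type :=
| Gate1 of 'I_m & 'M[C]_2
| Gate2 of 'I_m & 'I_m & 'M[C]_4.

Definition unitary (k : nat) (U : 'M[C]_k) : bool :=
  U *m (map_mx Num.conj U)^T == 1%:M.

Definition well_formed (m : nat) (g : gate m) : bool :=
  match g with
  | Gate1 _ U => unitary U
  | Gate2 q1 q2 U => (q1 != q2) && unitary U
  end.

(* Full 2^m x 2^m matrix of a gate (tensored with identity on the other
   qubits). For a 2-qubit gate on (q1,q2), q1 is the more significant bit of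
   the 4-dimensional gate index. *)
Definition gate_mx (m : nat) (g : gate m) : 'M[C]_(2 ^ m) :=
  match g with
  | Gate1 q U => \matrix_(i, j)
      if [forall p : 'I_m, (p == q) || (bitq p i == bitq p j)]
      then U (inord (bitq q i)) (inord (bitq q j)) else 0
  | Gate2 q1 q2 U => \matrix_(i, j)
      if [forall p : 'I_m, [|| p == q1, p == q2 | bitq p i == bitq p j]]
      then U (inord (2 * bitq q1 i + bitq q2 i)%N)
             (inord (2 * bitq q1 j + bitq q2 j)%N) else 0
  end.

(* Circuit [g1; ...; gL] (g1 applied first) has matrix G_L * ... * G_1. *)
Definition circuit_mx (m : nat) (gs : seq (gate m)) : 'M[C]_(2 ^ m) :=
  foldr (fun g M => M *m gate_mx g) 1%:M gs.

Definition conv_mx (n d : nat) (a : int -> C) : 'M[C]_(2 ^ n) :=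
  \matrix_(mm, j) \sum_(k < (2 * d).+1)
     (if ((mm%:Z - (k%:Z - d%:Z)) %% (2 ^ n)%:Z)%Z == j%:Z
      then a (k%:Z - d%:Z) else 0).

End Circuits.

Lemma pow2_leS (n : nat) : (2 ^ n <= 2 ^ n.+1)%N.
Proof. by rewrite leq_pexp2l. Qed.

(* The ancilla is qubit n (the most significant qubit) of an (n+1)-qubit
   register; this is the block <0|_anc W |0>_anc, i.e. the top-left
   2^n x 2^n block of W. *)
Definition anc0_block (R : realType) (n : nat) (W : 'M[R[i]]_(2 ^ n.+1))
  : 'M[R[i]]_(2 ^ n) :=
  \matrix_(i, j) W (widen_ord (pow2_leS n) i) (widen_ord (pow2_leS n) j).

(* Main.v *)
(* The discrete Fourier transform F diagonalizes the cyclic shift T, so that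
   F (sum_k a_k T^k) F^-1 is a Laurent polynomial in the diagonal matrix
   F T F^-1, which is a tensor product of one-qubit phase gates.  Multiplying
   by a power of this matrix turns the Laurent polynomial into a polynomial P of degree 2d,
   rescaled so that |P| < 1 on the unit circle.  By Fejer-Riesz there is a
   polynomial Q of the same degree with |P|^2 + |Q|^2 = 1 on the circle, and
   generalized quantum signal processing realizes (P, Q) as the first column of
   an alternating product of 2d + 1 rotations of the ancilla and 2d controlled
   copies of F T F^-1, each costing n two-qubit gates.  The Fourier transform
   (without the final bit reversal) costs O(n^2) gates. *)
Require Import Defs.
From HB Require Import structures.
From mathcomp Require Import all_boot all_order all_algebra.
From mathcomp Require Import complex reals.
From mathcomp Require Import ring zify.
Import Order.TTheory GRing.Theory Num.Theory.
Local Open Scope ring_scope.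

Set Implicit Arguments.
Unset Strict Implicit.
Unset Printing Implicit Defensive.

(** * Bits of basis indices *)

Lemma bitq_high (p k h l : nat) :
  (l < 2 ^ k)%N -> (k <= p)%N -> bitq p (h * 2 ^ k + l)%N = bitq (p - k) h.
Proof.
move=> ltl lekp; rewrite /bitq -{1}(subnKC lekp) expnD divnMA.
by rewrite divnMDl ?expn_gt0 // (divn_small ltl) addn0.
Qed.

Lemma bitq_low (p k h l : nat) :
  (p < k)%N -> bitq p (h * 2 ^ k + l)%N = bitq p l.
Proof.
move=> ltpk; rewrite /bitq -(subnK (ltnW ltpk)) expnD mulnA divnMDl ?expn_gt0 //.
by rewrite oddD oddM oddX subn_eq0 leqNgt ltpk /= andbF.
Qed.

Lemma bitq_mod (p k x : nat) : (p < k)%N -> bitq p (x %% 2 ^ k)%N = bitq p x.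
Proof. by move=> ltpk; rewrite [in RHS](divn_eq x (2 ^ k)) bitq_low. Qed.

Lemma modn_bitS (k x : nat) :
  (x %% 2 ^ k.+1 = bitq k x * 2 ^ k + x %% 2 ^ k)%N.
Proof.
rewrite {1}(divn_eq x (2 ^ k)) {1}(divn_eq (x %/ 2 ^ k) 2) modn2 -/(bitq k x).
rewrite mulnDl -mulnA -expnS -addnA modnMDl modn_small //.
have := ltn_pmod x (expn_gt0 2 k); case: (bitq k x); rewrite expnS; lia.
Qed.

Lemma eqn_mod_bitq (k x y : nat) :
  (forall p, (p < k)%N -> bitq p x = bitq p y) -> (x = y %[mod 2 ^ k])%N.
Proof.
elim: k => [|k IHk] eqb; first by rewrite !modn1.
by rewrite !modn_bitS eqb // IHk // => p ltpk; apply: eqb; apply: ltnW.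
Qed.

Section Indices.
Variable m : nat.
Implicit Types x y : 'I_(2 ^ m).

Lemma eq_bitq x y : (forall p : 'I_m, bitq p x = bitq p y) -> x = y.
Proof.
move=> eqb; apply/val_inj.
rewrite /= -(modn_small (ltn_ord x)) -(modn_small (ltn_ord y)).
by apply: eqn_mod_bitq => p ltpm; apply: (eqb (Ordinal ltpm)).
Qed.

(* Adds [j] to the [k] low bits of [x], modulo [2 ^ k]. *)
Definition addlow (k j : nat) x : 'I_(2 ^ m) :=
  insubd x (x %/ 2 ^ k * 2 ^ k + (x + j) %% 2 ^ k)%N.

(** The default [x] of [insubd] is never returned: by [splice_ltn] the spliced number stays below
    [2 ^ m]. *)
Definition setbit (q : 'I_m) (b : bool) x : 'I_(2 ^ m) :=
  insubd x (x %/ 2 ^ q.+1 * 2 ^ q.+1 + (b * 2 ^ q + x %% 2 ^ q))%N.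

Lemma splice_ltn (k l : nat) x :
  (k <= m)%N -> (l < 2 ^ k)%N -> (x %/ 2 ^ k * 2 ^ k + l < 2 ^ m)%N.
Proof.
move=> lekm ltl; have eqm : (2 ^ m = 2 ^ (m - k) * 2 ^ k)%N.
  by rewrite -expnD subnK.
have : (x %/ 2 ^ k < 2 ^ (m - k))%N by rewrite ltn_divLR ?expn_gt0 // -eqm.
move: eqm; nia.
Qed.

Lemma val_addlow (k j : nat) x : (k <= m)%N ->
  addlow k j x = (x %/ 2 ^ k * 2 ^ k + (x + j) %% 2 ^ k)%N :> nat.
Proof.
by move=> lekm; rewrite val_insubd splice_ltn // ltn_pmod ?expn_gt0.
Qed.

Lemma bitq_addlow (k j p : nat) x : (k <= m)%N ->
  bitq p (addlow k j x) = if (p < k)%N then bitq p (x + j)%N else bitq p x.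
Proof.
move=> lekm; rewrite val_addlow //; case: ltnP => ltpk.
  by rewrite bitq_low // bitq_mod.
rewrite bitq_high ?ltn_pmod ?expn_gt0 // [in RHS](divn_eq x (2 ^ k)).
by rewrite bitq_high ?ltn_pmod ?expn_gt0.
Qed.

Lemma bitq_setbit (q : 'I_m) (b : bool) x (p : nat) :
  bitq p (setbit q b x) = if p == q then b else bitq p x.
Proof.
have ltq : (x %% 2 ^ q < 2 ^ q)%N by rewrite ltn_pmod ?expn_gt0.
have ltl : (b * 2 ^ q + x %% 2 ^ q < 2 ^ q.+1)%N.
  by rewrite expnS; case: (b); lia.
rewrite val_insubd splice_ltn //; case: (ltngtP p q) => [ltpq|ltqp|->].
- by rewrite bitq_low ?(leqW ltpq) // bitq_low // bitq_mod.
- rewrite bitq_high // [in RHS](divn_eq x (2 ^ q.+1)).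
  by rewrite bitq_high // ltn_pmod ?expn_gt0.
- by rewrite bitq_low // bitq_high // subnn /bitq divn1 oddb.
Qed.

Lemma setbit_id (q : 'I_m) x : setbit q (bitq q x) x = x.
Proof.
by apply: eq_bitq => p; rewrite bitq_setbit; case: eqP => // ->.
Qed.

Lemma setbitK (q : 'I_m) (b c : bool) x :
  setbit q b (setbit q c x) = setbit q b x.
Proof. by apply: eq_bitq => p; rewrite !bitq_setbit; case: eqP. Qed.

Lemma modn_setbit (q : 'I_m) (b : bool) x (k : nat) :
  (k <= q)%N -> (setbit q b x = x %[mod 2 ^ k])%N.
Proof.
move=> lekq; apply: eqn_mod_bitq => p ltpk; rewrite bitq_setbit.
by rewrite ltn_eqF // (leq_trans ltpk).
Qed.

(** The two additions differ only in bit [k], which is then overwritten. *)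
Lemma setbit_addlowS (k : 'I_m) (b : bool) (j : nat) x :
  setbit k b (addlow k.+1 j x) = setbit k b (addlow k j x).
Proof.
apply: eq_bitq => p; rewrite !bitq_setbit !bitq_addlow //; last exact: ltnW.
by rewrite ltnS; case: (ltngtP p k).
Qed.

Lemma addlow_setbit (k : 'I_m) (b : bool) (j : nat) x :
  addlow k j (setbit k b x) = setbit k b (addlow k j x).
Proof.
have lekm := ltnW (ltn_ord k); apply: eq_bitq => p.
rewrite bitq_setbit !bitq_addlow // bitq_setbit; case: (ltngtP p k) => // ltpk.
by rewrite -(bitq_mod (_ + j) ltpk) -modnDml modn_setbit // modnDml bitq_mod.
Qed.

Lemma addlow0 (j : nat) x : addlow 0 j x = x.
Proof. by apply: eq_bitq => p; rewrite bitq_addlow. Qed.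

Lemma modn_addlow (k j : nat) x : (k <= m)%N ->
  (addlow k j x = x + j %[mod 2 ^ k])%N.
Proof. by move=> lekm; rewrite val_addlow // modnMDl modn_mod. Qed.

End Indices.

(** * Polynomials on the unit circle *)

Section UnitCircle.
Variable C : numClosedFieldType.
Implicit Types (z w r c s : C) (P Q G : {poly C}).

Lemma norm1_neq0 z : `|z| = 1 -> z != 0.
Proof. by move=> z1; rewrite -normr_eq0 z1 oner_eq0. Qed.

Lemma norm1_conj z : `|z| = 1 -> z^* = z^-1.
Proof. by move=> z1; rewrite invC_norm z1 expr1n invr1 mul1r. Qed.

(* A primitive root of unity of order [2 ^ k.+1]. *)
Fixpoint zeta (k : nat) : C := if k is k'.+1 then sqrtC (zeta k') else -1.

Lemma zeta_exp2 k : zeta k ^+ (2 ^ k) = -1.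
Proof. by elim: k => [|k IHk]; rewrite ?expr1 // expnS exprM sqrtCK. Qed.

Lemma zeta_period k : zeta k ^+ (2 ^ k.+1) = 1.
Proof. by rewrite expnSr exprM zeta_exp2 sqrrN expr1n. Qed.

Lemma zeta_mod k i : zeta k ^+ (i %% 2 ^ k.+1)%N = zeta k ^+ i.
Proof. by rewrite expr_mod // zeta_period. Qed.

Lemma norm_zeta k : `|zeta k| = 1.
Proof.
elim: k => [|k IHk]; first by rewrite normrN1.
by apply/eqP; rewrite -(@pexpr_eq1 _ _ 2) // -normrX sqrtCK IHk.
Qed.

(** For [i < j], raising to the power [2 ^ j] sends [zeta i] to 1 but [zeta j] to -1. This gives
    infinitely many points on the unit circle. *)
Lemma zeta_inj : injective zeta.
Proof.
have zeta_neq i j : (i < j)%N -> zeta i != zeta j.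
  move=> ltij; apply/eqP => eq_ij; have := zeta_exp2 j.
  rewrite -eq_ij -(subnKC ltij) expnD exprM zeta_period expr1n => /eqP.
  by rewrite -subr_eq0 opprK -(natrD C 1 1) pnatr_eq0.
move=> i j eq_ij; case: (ltngtP i j) => // /zeta_neq.
  by rewrite eq_ij eqxx.
by rewrite eq_ij eqxx.
Qed.

Lemma poly_eq_on_circle P Q : (forall z, `|z| = 1 -> P.[z] = Q.[z]) -> P = Q.
Proof.
move=> eqPQ; apply/eqP; rewrite -subr_eq0; apply/negP => /negP nz.
have /(max_poly_roots nz) : all (root (P - Q)) (mkseq zeta (size (P - Q))).
  apply/allP => _ /mapP[k _ ->].
  by rewrite rootE hornerD hornerN eqPQ ?subrr ?norm_zeta.
rewrite mkseq_uniq ?size_mkseq ?ltnn; last exact: zeta_inj.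
by move=> /(_ isT).
Qed.

(** The reciprocal polynomial of [P]: on the circle it equals [z ^+ D] times the conjugate of [P],
    so identities involving [|P|^2] become polynomial ones. *)
Definition conj_rev (D : nat) P : {poly C} := \poly_(i < D.+1) (P`_(D - i))^*.

Lemma horner_conj_rev D P z : (size P <= D.+1)%N -> z != 0 ->
  (conj_rev D P).[z] = z ^+ D * (P.[(z^*)^-1])^*.
Proof.
move=> szP nz; rewrite horner_poly (horner_coef_wide _ szP) rmorph_sum mulr_sumr.
rewrite (reindex_inj rev_ord_inj); apply: eq_bigr => i _ /=.
have lei : (i <= D)%N by rewrite -ltnS.
rewrite subSS subKn // rmorphM rmorphXn /= fmorphV /= conjCK mulrCA; congr (_ * _).
by rewrite expfB_cond ?(negbTE nz) // exprVn.
Qed.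

Lemma horner_conj_rev1 D P z : (size P <= D.+1)%N -> `|z| = 1 ->
  (conj_rev D P).[z] = z ^+ D * (P.[z])^*.
Proof.
move=> szP z1; rewrite horner_conj_rev ?norm1_neq0 //.
by rewrite (norm1_conj z1) // invrK.
Qed.

(* Strict positivity keeps the roots of [G] off the unit circle, so a root
   and its inverse in the circle are distinct, and are removed together. *)
Lemma Fejer_Riesz D G : (size G <= D.*2.+1)%N ->
    (forall z, `|z| = 1 -> 0 < G.[z] * z^-1 ^+ D) ->
  exists2 Q : {poly C}, (size Q <= D.+1)%N &
    forall z, `|z| = 1 -> G.[z] * z^-1 ^+ D = `|Q.[z]| ^+ 2.
Proof.
elim: D G => [|D IHD] G szG posG.
  have eG := size1_polyC szG; set c := G`_0 in eG.
  have c_gt0 : 0 < c by have := posG 1 (normr1 _); rewrite eG hornerC mulr1.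
  exists (sqrtC c)%:P => [|z _]; first exact: size_polyC_leq1.
  by rewrite eG !hornerC mulr1 ger0_norm ?sqrtC_ge0 ?ltW // sqrtCK.
have revG : conj_rev D.+1.*2 G = G.
  apply: poly_eq_on_circle => z z1; rewrite horner_conj_rev1 //.
  have nz := norm1_neq0 z1; have := conj_Creal (gtr0_real (posG z z1)).
  rewrite rmorphM rmorphXn /= fmorphV /= (norm1_conj z1) // invrK => e.
  rewrite -addnn exprD -mulrA (mulrC (z ^+ D.+1) (G.[z])^*) e mulrCA.
  by rewrite -exprMn mulfV // expr1n mulr1.
have coefG i : (i <= D.+1.*2)%N -> G`_i = (G`_(D.+1.*2 - i))^*.
  by move=> lei; rewrite -[in LHS]revG coef_poly ltnS lei.
(* If the constant coefficient vanishes, so does the top one by symmetry; dividing by ['X] then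
   lowers the size bound by two. *)
have [G0|nzG0] := eqVneq G`_0 0.
  have G2D : G`_(D.+1.*2) = 0 by rewrite coefG // subnn G0 conjC0.
  have /factor_theorem[H eG] : root G 0 by rewrite rootE horner_coef0 G0.
  rewrite subr0 in eG.
  have szH : (size H <= D.*2.+1)%N.
    apply/leq_sizeP => i lei; have := coefMX H i.+1; rewrite -eG /= => <-.
    move: lei; rewrite leq_eqVlt => /orP[/eqP <-|lti]; first exact: G2D.
    by apply: (leq_sizeP _ _ szG).
  have eqGH z : `|z| = 1 -> G.[z] * z^-1 ^+ D.+1 = H.[z] * z^-1 ^+ D.
    move=> z1; rewrite eG hornerM hornerX exprS -mulrA; congr (_ * _).
    by rewrite mulVKf ?norm1_neq0.
  have [z z1|Q szQ eqQ] := IHD H szH; first by rewrite -eqGH ?posG.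
  by exists Q => [|z z1]; [exact: leqW | rewrite eqGH ?eqQ].
have [r rG] : exists r, root G r.
  apply/closed_rootP; rewrite neq_ltn orbC; apply/orP; left.
  rewrite ltnNge; apply/negP => /leq_sizeP/(_ D.+1.*2 isT) G2D.
  by move: nzG0; rewrite coefG // subn0 G2D conjC0 eqxx.
have nzr : r != 0.
  by apply: contraNneq nzG0 => r0; rewrite -horner_coef0 -[X in _.[X]]r0.
have nr1 : `|r| != 1.
  apply/eqP => /posG; rewrite (rootP rG) mul0r ltxx //.
have nzrc : r^* != 0 by rewrite conjC_eq0.
have /factor_theorem[H eG] := rG.
pose t := (r^*)^-1; have rGt : root G t.
  rewrite rootE -revG horner_conj_rev ?invr_eq0 //.
  by rewrite /t fmorphV /= invrK conjCK (rootP rG) conjC0 mulr0.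
have nztr : t - r != 0.
  rewrite subr_eq0; apply: contra nr1 => /eqP etr.
  by rewrite -(@pexpr_eq1 _ _ 2) // normCK -{1}etr mulVf.
have /factor_theorem[K eH] : root H t.
  move: rGt; rewrite eG rootE hornerM hornerXsubC mulf_eq0 (negbTE nztr).
  by rewrite orbF.
have nzG : G != 0 by apply: contraNneq nzG0 => ->; rewrite coef0.
have nzK : K != 0 by apply: contraNneq nzG => K0; rewrite eG eH K0 !mul0r.
(* On the circle [(z - r) * (z - t) = - t * z * |z - r|^2]; the factor [- t] is absorbed here, and
   [z] cancels one power of [z^-1]. *)
pose K' := (- t) *: K.
have szK : (size K' <= D.*2.+1)%N.
  rewrite (leq_trans (size_scale_leq _ _)) //.
  move: szG; rewrite eG eH !size_Mmonic ?monicXsubC ?mulf_neq0 ?polyXsubC_eq0 //.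
  by rewrite !size_XsubC !addn2 doubleS.
have eqGK z : `|z| = 1 ->
    G.[z] * z^-1 ^+ D.+1 = `|z - r| ^+ 2 * (K'.[z] * z^-1 ^+ D).
  move=> z1; rewrite eG eH !hornerM !hornerXsubC hornerZ exprS normCK.
  rewrite rmorphB /= (norm1_conj z1) // /t.
  have nz := norm1_neq0 z1; field; by rewrite nz nzrc.
have pos_zr z : `|z| = 1 -> 0 < `|z - r| ^+ 2.
  move=> z1; rewrite exprn_gt0 // normr_gt0 subr_eq0.
  by apply: contra nr1 => /eqP <-; rewrite z1.
have [z z1|Q szQ eqQ] := IHD K' szK.
  by have := posG z z1; rewrite eqGK // pmulr_rgt0 ?pos_zr.
exists (Q * ('X - r%:P)) => [|z z1].
  have [->|nzQ] := eqVneq Q 0; first by rewrite mul0r size_poly0.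
  by rewrite size_Mmonic ?monicXsubC // size_XsubC addn2.
by rewrite eqGK // eqQ // hornerM hornerXsubC normrM exprMn mulrC.
Qed.

(** Normalize [(p, q)]; if it is zero, normalize a vector orthogonal to [(p', q')] instead, or take
    [(1, 0)] if both pairs are zero. The result defines the rotation in a signal processing step. *)
Lemma unit_vector_along p q p' q' : p * p'^* + q * q'^* = 0 ->
  exists c s : C, [/\ c * c^* + s * s^* = 1, s * p = c * q
                & c^* * p' + s^* * q' = 0].
Proof.
pose nrm x y : C := sqrtC (x * x^* + y * y^*).
have nrm_ge0 x y : 0 <= nrm x y.
  by rewrite sqrtC_ge0 addr_ge0 // mul_conjC_ge0.
have nrm_conj x y : (nrm x y)^* = nrm x y by rewrite conj_Creal ?ger0_real.
have nrm0 x y : nrm x y = 0 -> x = 0 /\ y = 0.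
  move/eqP; rewrite sqrtC_eq0 paddr_eq0 ?mul_conjC_ge0 // !mul_conjC_eq0.
  by case/andP => /eqP -> /eqP ->.
have unit x y : nrm x y != 0 ->
    x / nrm x y * (x / nrm x y)^* + y / nrm x y * (y / nrm x y)^* = 1.
  move=> nz; rewrite !rmorphM !fmorphV /= !nrm_conj.
  transitivity ((x * x^* + y * y^*) / nrm x y ^+ 2); first by field.
  by rewrite sqrtCK mulfV // -sqrtC_eq0.
move=> ort; have [/nrm0[-> ->]|nz] := eqVneq (nrm p q) 0.
  have [/nrm0[/eqP q0 /eqP p0]|nz'] := eqVneq (nrm q'^* (- p'^*)) 0.
    move: q0 p0; rewrite oppr_eq0 !conjC_eq0 => /eqP -> /eqP ->.
    exists 1, 0; split; rewrite ?(mulr0, mul0r, addr0, conjC0) //.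
    by rewrite conjC1 mulr1.
  exists (q'^* / nrm q'^* (- p'^*)), (- p'^* / nrm q'^* (- p'^*)).
  split; [exact: unit | by rewrite !mulr0 |].
  by rewrite !rmorphM /= !fmorphV /= rmorphN /= !conjCK !nrm_conj; field.
exists (p / nrm p q), (q / nrm p q); split; [exact: unit | by ring |].
rewrite !rmorphM !fmorphV /= !nrm_conj.
have := congr1 (@Num.conj C) ort.
rewrite rmorphD !rmorphM /= !conjCK conjC0 => e.
transitivity ((p^* * p' + q^* * q') / nrm p q); first by ring.
by rewrite e mul0r.
Qed.

End UnitCircle.

(** * Circuits and their action on basis states *)

Section Gates.
Variables (R : realType) (m : nat).
Local Notation C := R[i].
Implicit Types (A B : 'M[C]_(2 ^ m)) (x y : 'I_(2 ^ m)) (w : C).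

Definition ket x : 'cV[C]_(2 ^ m) := delta_mx x 0.

Lemma eq_mx_ket A B : (forall x, A *m ket x = B *m ket x) -> A = B.
Proof.
move=> eqAB; apply/matrixP => x y.
by have := congr1 (fun v : 'cV_(2 ^ m) => v x 0) (eqAB y); rewrite -!colE !mxE.
Qed.

Definition dg (f : 'I_(2 ^ m) -> C) : 'M[C]_(2 ^ m) := diag_mx (\row_x f x).

Lemma dg_ket f x : dg f *m ket x = f x *: ket x.
Proof.
apply/colP => y; rewrite mul_diag_mx !mxE.
by case: eqP => [->|]; rewrite ?mulr0.
Qed.

Lemma mul_dg f g : dg f *m dg g = dg (fun x => f x * g x).
Proof.
apply: eq_mx_ket => x.
by rewrite -mulmxA !dg_ket -scalemxAr dg_ket scalerA mulrC.
Qed.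

Lemma eq_dg f g : f =1 g -> dg f = dg g.
Proof. by move=> eqfg; apply: eq_mx_ket => x; rewrite !dg_ket eqfg. Qed.

Lemma dg1 f : (forall x, f x = 1) -> dg f = 1%:M.
Proof.
by move=> f1; apply: eq_mx_ket => x; rewrite dg_ket f1 scale1r mul1mx.
Qed.

Definition implementable (k : nat) A : Prop :=
  exists gs : seq (gate R m),
    [/\ all (@well_formed R m) gs, (size gs <= k)%N & circuit_mx gs = A].

Lemma implementable_leq k l A :
  (k <= l)%N -> implementable k A -> implementable l A.
Proof.
by move=> lekl [gs [wf sz <-]]; exists gs; split=> //; apply: leq_trans lekl.
Qed.

Lemma implementable1 : implementable 0 1%:M.
Proof. by exists [::]. Qed.

Lemma implementable_mul k l A B :
  implementable k A -> implementable l B -> implementable (k + l) (B *m A).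
Proof.
move=> [gs [wfg szg <-]] [hs [wfh szh <-]]; exists (gs ++ hs).
split; [by rewrite all_cat wfg | by rewrite size_cat leq_add |].
by elim: gs {wfg szg} => [|g gs IHgs] /=; rewrite ?mulmx1 // IHgs mulmxA.
Qed.

Lemma implementable_gate g : well_formed g -> implementable 1 (gate_mx g).
Proof. by move=> wfg; exists [:: g]; rewrite /= wfg mul1mx. Qed.

Lemma implementable_dg_prod k (f : nat -> 'I_(2 ^ m) -> C) :
    (forall p, (p < k)%N -> implementable 1 (dg (f p))) ->
  implementable k (dg (fun x => \prod_(p < k) f p x)).
Proof.
elim: k => [|k IHk] impf.
  by rewrite dg1 => [|x]; [exact: implementable1 | rewrite big_ord0].
have -> : dg (fun x => \prod_(p < k.+1) f p x) =
    dg (f k) *m dg (fun x => \prod_(p < k) f p x).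
  by rewrite mul_dg; apply: eq_dg => x; rewrite big_ord_recr mulrC.
rewrite -addn1; apply: implementable_mul; last exact: impf.
by apply: IHk => p ltpk; apply: impf; apply: ltnW.
Qed.

Definition mx2 (f : bool -> bool -> C) : 'M[C]_2 :=
  \matrix_(i, j) f (odd i) (odd j).

Lemma mx2E f (b c : bool) : mx2 f (inord b) (inord c) = f b c.
Proof. by rewrite mxE !inordK ?oddb; do ?case: b; do ?case: c. Qed.

Lemma unitary_mx2 f :
    (forall b c, f b false * (f c false)^* + f b true * (f c true)^*
                 = (b == c)%:R) ->
  unitary (mx2 f).
Proof.
move=> uf; apply/eqP/matrixP => i j; rewrite !mxE.
rewrite big_ord_recl big_ord1 !mxE /= uf; congr (_%:R).
by case: i j => [[|[|i]] ?] [[|[|j]] ?].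
Qed.

Lemma gate1_ket (q : 'I_m) f x :
  gate_mx (Gate1 q (mx2 f)) *m ket x =
    f false (bitq q x) *: ket (setbit q false x) +
    f true (bitq q x) *: ket (setbit q true x).
Proof.
rewrite -colE; apply/colP => y; rewrite [LHS]mxE [LHS]mxE mx2E !mxE.
case: ifP => [/forallP agr|nagr].
  have -> : y = setbit q (bitq q y) x.
    apply: eq_bitq => p; rewrite bitq_setbit; case: eqP => [->//|/eqP npq].
    by have /orP[/eqP epq|/eqP//] := agr p; rewrite epq eqxx in npq.
  have eqs b c : (setbit q b x == setbit q c x) = (b == c).
    apply/eqP/eqP => [/(congr1 (fun z : 'I_(2 ^ m) => bitq q z))|->] //.
    by rewrite !bitq_setbit eqxx.
  rewrite bitq_setbit eqxx !eqs.
  by case: (bitq q y); rewrite ?(mulr1, mulr0, addr0, add0r).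
have neq b : (y == setbit q b x) = false.
  apply/negP => /eqP ey; case/negP: nagr; apply/forallP => p.
  by rewrite ey bitq_setbit -val_eqE /=; case: eqP => //= _.
by rewrite !neq !mulr0 addr0.
Qed.

Definition phase (q : nat) w x : C := if bitq q x then w else 1.

Lemma implementable_phase q w : (q < m)%N -> `|w| = 1 ->
  implementable 1 (dg (phase q w)).
Proof.
move=> ltqm w1; pose f b c : C := if b == c then if b then w else 1 else 0.
have -> : dg (phase q w) = gate_mx (Gate1 (Ordinal ltqm) (mx2 f)).
  apply: eq_mx_ket => x; rewrite gate1_ket dg_ket /f /phase /=.
  have := setbit_id (Ordinal ltqm) x; case: (bitq q x) => /= ->.
    by rewrite scale0r add0r.
  by rewrite scale0r addr0.
apply: implementable_gate; apply: unitary_mx2 => b c.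
have ww : w * w^* = 1 by rewrite -normCK w1 expr1n.
by case: b; case: c; rewrite /f /= ?conjC0 ?conjC1
  ?(mulr0, mul0r, addr0, add0r, mulr1).
Qed.

Definition cphase (p q : nat) w x : C := if bitq p x && bitq q x then w else 1.

Lemma implementable_cphase p q w : (p < m)%N -> (q < m)%N -> p != q ->
  `|w| = 1 -> implementable 1 (dg (cphase p q w)).
Proof.
move=> ltpm ltqm npq w1.
have lt4 (b c : bool) : (2 * b + c < 4)%N by case: b; case: c.
(* Index 3 is [2 * 1 + 1], the case where both bits are set. *)
pose U : 'M[C]_4 := diag_mx (\row_i if i == 3 :> nat then w else 1).
have -> : dg (cphase p q w) = gate_mx (Gate2 (Ordinal ltpm) (Ordinal ltqm) U).
  apply/matrixP => x y; rewrite !mxE; case: (eqVneq x y) => [->|nxy].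
    rewrite ifT; last by apply/forallP => r; rewrite eqxx !orbT.
    rewrite eqxx mulr1n /cphase.
    by rewrite inordK ?lt4 //; case: (bitq p y); case: (bitq q y).
  rewrite mulr0n; case: ifP => // /forallP agr.
  rewrite -val_eqE /= !inordK ?lt4 //.
  have [eqb|_] := eqVneq (2 * bitq p x + bitq q x)%N
    (2 * bitq p y + bitq q y)%N; last by [].
  case/negP: nxy; apply/eqP; apply: eq_bitq => r.
  have [eqp eqq] : bitq p x = bitq p y /\ bitq q x = bitq q y.
    move: eqb; case: (bitq p x); case: (bitq q x);
    by case: (bitq p y); case: (bitq q y).
  by case/or3P: (agr r) => /eqP // ->.
apply: implementable_gate; rewrite /= -val_eqE /= npq /=; apply/eqP.
have ww : w * w^* = 1 by rewrite -normCK w1 expr1n.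
apply/matrixP => i j; rewrite mul_diag_mx !mxE eq_sym.
case: (eqVneq i j) => [->|_]; last by rewrite !mulr0n conjC0 mulr0.
by case: j => [[|[|[|[|j]]]] ltj] //=; rewrite !mulr1n ?conjC1 ?mulr1.
Qed.

End Gates.

(** * The Fourier transform *)

(** The binary expansion of the exponent splits a phase depending on [x] into one factor per
    qubit. *)
Lemma prod_exp_bitq (A : pzSemiRingType) (w : A) (k x : nat) :
  \prod_(p < k) (if bitq p x then w ^+ (2 ^ p) else 1) = w ^+ (x %% 2 ^ k)%N.
Proof.
elim: k => [|k IHk]; first by rewrite big_ord0 modn1.
rewrite big_ord_recr /= IHk modn_bitS addnC exprD.
by case: (bitq k x); rewrite ?mul1n // mul0n.
Qed.

Section Fourier.
Variables (R : realType) (m : nat).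
Local Notation C := R[i].
Local Notation ket := (@ket R m).
Local Notation implementable := (@implementable R m).
Implicit Types (x y : 'I_(2 ^ m)) (w : C).

Definition shift_mx (k j : nat) : 'M[C]_(2 ^ m) :=
  \matrix_(y, x) (y == addlow k j x)%:R.

Lemma shift_ket k j x : shift_mx k j *m ket x = ket (addlow k j x).
Proof. by rewrite -colE; apply/colP => y; rewrite !mxE andbT. Qed.

Lemma phase_setbit (k : 'I_m) (q : nat) (b : bool) w x : q != k ->
  phase q w (setbit k b x) = phase q w x.
Proof. by move=> nqk; rewrite /phase bitq_setbit (negbTE nqk). Qed.

Lemma implementable_hadamard (k : 'I_m) :
  exists H : 'M[C]_(2 ^ m), [/\ implementable 1 H, H *m H = 1%:M &
    forall x, H *m ket x = (sqrtC 2)^-1 *: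
      (ket (setbit k false x) + (-1) ^+ bitq k x *: ket (setbit k true x))].
Proof.
set h : C := (sqrtC 2)^-1.
have hh : h * h + h * h = 1.
  by rewrite /h -invfM -expr2 sqrtCK -[_^-1]mul1r -splitr.
have hconj : h^* = h.
  by rewrite conj_Creal // ger0_real // invr_ge0 sqrtC_ge0 ler0n.
pose f (b c : bool) : C := h * (-1) ^+ (b && c).
pose H := gate_mx (Gate1 k (mx2 f)).
have Hket x : H *m ket x = h *:
    (ket (setbit k false x) + (-1) ^+ bitq k x *: ket (setbit k true x)).
  by rewrite gate1_ket /f /= mulr1 scalerDr scalerA.
exists H; split=> //.
  apply: implementable_gate; apply: unitary_mx2 => b c.
  rewrite /f !rmorphM !rmorphXn /= hconj rmorphN1 !andbF !andbT /=.
  by case: b; case: c => /=; rewrite ?expr0 ?expr1;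
    first [ring | rewrite -[RHS]hh; ring].
apply: eq_mx_ket => x; rewrite -mulmxA Hket -scalemxAr mulmxDr -scalemxAr !Hket.
rewrite !setbitK !bitq_setbit eqxx mul1mx -[in RHS](setbit_id k x).
rewrite expr0 expr1 scale1r scaleN1r.
case: (bitq k x); rewrite ?scaleN1r ?scale1r -?scalerBr -?scalerDr scalerA.
  rewrite opprB [_ + ket _]addrC addrACA subrr addr0.
  by rewrite scalerDr -scalerDl hh scale1r.
by rewrite addrACA subrr addr0 scalerDr -scalerDl hh scale1r.
Qed.

(* Qubit [k] receives the phase [zeta k ^+ x], which depends on the bits
   [0 .. k] of [x] only: a Hadamard gate supplies the contribution of bit [k],
   controlled phases those of the lower bits. *)
Lemma fourier_step (k : 'I_m) :
  exists L L' : 'M[C]_(2 ^ m),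
    [/\ implementable k.+1 L, implementable k.+1 L', L' *m L = 1%:M &
    forall x, L *m ket x = (sqrtC 2)^-1 *:
      (ket (setbit k false x) + zeta C k ^+ x *: ket (setbit k true x))].
Proof.
have [H [impH HH Hket]] := implementable_hadamard k.
(* When bit [k] of [x] is set, this product is [w ^+ (x %% 2 ^ k)]; otherwise it is 1. *)
pose v w x := \prod_(p < k) cphase p k (w ^+ (2 ^ p)) x.
have impV w : `|w| = 1 -> implementable k (dg (v w)).
  move=> w1; apply: (@implementable_dg_prod _ _ _
    (fun p => cphase p k (w ^+ (2 ^ p)))) => p ltpk.
  apply: implementable_cphase => //; first exact: ltn_trans ltpk (ltn_ord k).
    by rewrite ltn_eqF.
  by rewrite normrX w1 expr1n.
have z1 := norm_zeta C k; have nz := norm1_neq0 z1.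
exists (dg (v (zeta C k)) *m H), (H *m dg (v (zeta C k)^-1)).
split.
- by rewrite -add1n; apply: implementable_mul => //; apply: impV.
- rewrite -addn1; apply: implementable_mul => //; apply: impV.
  by rewrite normfV z1 invr1.
- rewrite mulmxA -(mulmxA H) mul_dg dg1 ?mulmx1 // => x.
  rewrite /v -big_split big1 // => p _ /=; rewrite /cphase.
  by case: ifP => _; rewrite ?mulr1 // -exprMn mulVf // expr1n.
move=> x; rewrite -mulmxA Hket -scalemxAr mulmxDr -scalemxAr !dg_ket scalerA.
congr (_ *: (_ + _ *: _)).
  rewrite /v big1 ?scale1r // => p _.
  by rewrite /cphase !bitq_setbit eqxx andbF.
have -> : v (zeta C k) (setbit k true x) = zeta C k ^+ (x %% 2 ^ k)%N.
  rewrite -prod_exp_bitq; apply: eq_bigr => p _.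
  by rewrite /cphase !bitq_setbit eqxx andbT ltn_eqF.
rewrite -[in RHS]zeta_mod modn_bitS exprD; congr (_ * _).
by case: (bitq k x); rewrite ?mul1n ?zeta_exp2.
Qed.

(** The top qubit is transformed first, then the lower ones by induction. The commutation clause
    drives the induction and later protects the ancilla; [w] is unrestricted there so that [w = 0]
    yields a projector. *)
Lemma fourier_transform (n : nat) : (n <= m)%N ->
  exists F F' : 'M[C]_(2 ^ m),
    [/\ implementable (n ^ 2) F, implementable (n ^ 2) F', F' *m F = 1%:M,
      forall j, F *m shift_mx n j =
        dg (fun x => \prod_(p < n) phase p (zeta C p ^+ j) x) *m F &
      forall q w, (n <= q)%N ->
        F *m dg (phase q w) = dg (phase q w) *m F].
Proof.
elim: n => [|k IHk] ltkm.
  exists 1%:M, 1%:M; split; rewrite ?mulmx1 //; try exact: implementable1.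
    move=> j; rewrite mulmx1 mul1mx dg1 => [|x]; last by rewrite big_ord0.
    by apply: eq_mx_ket => x; rewrite shift_ket addlow0 mul1mx.
  by move=> q w _; rewrite mulmx1 mul1mx.
have [F [F' [impF impF' FF FT Fq]]] := IHk (ltnW ltkm).
have [L [L' [impL impL' LL Lket]]] := fourier_step (Ordinal ltkm).
have le_sq : (k.+1 + k ^ 2 <= k.+1 ^ 2)%N by nia.
exists (F *m L), (L' *m F'); split.
- exact/(implementable_leq le_sq)/implementable_mul.
- by apply: (implementable_leq le_sq); rewrite addnC; apply: implementable_mul.
- by rewrite mulmxA -(mulmxA L') FF mulmx1.
- move=> j; have -> : dg (fun x => \prod_(p < k.+1) phase p (zeta C p ^+ j) x)
      = dg (phase k (zeta C k ^+ j)) *m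
        dg (fun x => \prod_(p < k) phase p (zeta C p ^+ j) x).
    by rewrite mul_dg; apply: eq_dg => x; rewrite big_ord_recr mulrC.
  (* The phase on qubit [k] commutes with [F], which leaves an intertwining relation for [L] alone,
     checked on basis states. *)
  rewrite [RHS]mulmxA -[in RHS](mulmxA (dg _)) -FT [in RHS]mulmxA -Fq //.
  rewrite -!mulmxA; congr (F *m _); apply: eq_mx_ket => x.
  rewrite -!mulmxA shift_ket !Lket -!scalemxAr !mulmxDr -!scalemxAr !shift_ket.
  rewrite !dg_ket !(addlow_setbit (Ordinal ltkm)) !(setbit_addlowS (Ordinal ltkm)).
  rewrite /phase !bitq_setbit eqxx.
  rewrite scale1r scalerA -exprD; congr (_ *: (_ + _ *: _)).
  (* Since [zeta k ^+ (2 ^ k.+1) = 1], the carry lost beyond bit [k] does not affect the phase. *)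
  by rewrite -zeta_mod modn_addlow // zeta_mod.
- move=> q w ltkq; rewrite mulmxA -Fq ?(ltnW ltkq) // -!mulmxA.
  congr (F *m _); apply: eq_mx_ket => x.
  rewrite -!mulmxA dg_ket -!scalemxAr !Lket -!scalemxAr mulmxDr -scalemxAr.
  rewrite !dg_ket !phase_setbit ?gtn_eqF //.
  rewrite (scalerA (_ ^+ x)) (mulrC (_ ^+ x)) -scalerA -scalerDr.
  by rewrite !scalerA mulrC.
Qed.

End Fourier.

(** * Quantum signal processing *)

Section SignalProcessing.
Variables (R : realType) (n : nat).
Local Notation C := R[i].
Local Notation ket := (@ket R n.+1).
Local Notation implementable := (@implementable R n.+1).
Implicit Types (x y : 'I_(2 ^ n.+1)) (c s w z : C) (P Q : {poly C}).

Local Notation anc := (@ord_max n).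

Definition shift_eigenvalue x : C := \prod_(p < n) phase p (zeta C p) x.

Lemma shift_eigenvalue_exp j x :
  \prod_(p < n) phase p (zeta C p ^+ j) x = shift_eigenvalue x ^+ j.
Proof.
rewrite -prodrXl; apply: eq_bigr => p _; rewrite /phase.
by case: ifP; rewrite ?expr1n.
Qed.

Lemma implementable_shift_eigenvalue_exp j :
  implementable n (dg (fun x => shift_eigenvalue x ^+ j)).
Proof.
rewrite (eq_dg (fun x => esym (shift_eigenvalue_exp j x))).
apply: (@implementable_dg_prod _ _ _ (fun p => phase p (zeta C p ^+ j))) => p ltpn.
by apply: implementable_phase; rewrite ?normrX ?norm_zeta ?expr1n // leqW.
Qed.

Lemma implementable_rotation (q : 'I_n.+1) c s : c * c^* + s * s^* = 1 ->
  exists2 V : 'M[C]_(2 ^ n.+1), implementable 1 V &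
    forall x, V *m ket x =
      if bitq q x
      then - s^* *: ket (setbit q false x) + c^* *: ket (setbit q true x)
      else c *: ket (setbit q false x) + s *: ket (setbit q true x).
Proof.
move=> cs1; pose f (a b : bool) : C :=
  if b then (if a then c^* else - s^*) else (if a then s else c).
exists (gate_mx (Gate1 q (mx2 f))) => [|x]; last first.
  by rewrite gate1_ket /f; case: bitq.
apply: implementable_gate; apply: unitary_mx2 => a b.
by case: a; case: b; rewrite /f /= ?rmorphN /= ?conjCK;
  first [ring | rewrite -[RHS]cs1; ring].
Qed.

Lemma implementable_controlled_shift_eigenvalue :
  exists2 V : 'M[C]_(2 ^ n.+1), implementable n V &
    forall x, V *m ket x =
      (if bitq n x then shift_eigenvalue x else 1) *: ket x.
Proof.
exists (dg (fun x => \prod_(p < n) cphase n p (zeta C p) x)) => [|x].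
  apply: (@implementable_dg_prod _ _ _ (fun p => cphase n p (zeta C p))) => p ltpn.
  apply: implementable_cphase; [exact: ltnSn | exact: leqW | | exact: norm_zeta].
  by rewrite gtn_eqF.
rewrite dg_ket; congr (_ *: _).
rewrite /cphase; case: (bitq n x) => /=; first by apply: eq_bigr.
by rewrite big1.
Qed.

Lemma shift_eigenvalue_setbit b x :
  shift_eigenvalue (setbit anc b x) = shift_eigenvalue x.
Proof. by apply: eq_bigr => p _; rewrite phase_setbit ?ltn_eqF. Qed.

(* Generalized quantum signal processing: comparing the coefficients of degree
   [D.+1] in [|P|^2 + |Q|^2 = 1] shows that the lowest and highest coefficients
   of the pair [(P, Q)] are orthogonal, so one rotation lowers the degree. *)
Lemma signal_processing D P Q :
    (size P <= D.+1)%N -> (size Q <= D.+1)%N ->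
    (forall z, `|z| = 1 -> P.[z] * (P.[z])^* + Q.[z] * (Q.[z])^* = 1) ->
  exists2 M : 'M[C]_(2 ^ n.+1), implementable (D * n.+1 + 1) M &
    forall x, ~~ bitq n x ->
      M *m ket x = P.[shift_eigenvalue x] *: ket x +
                   Q.[shift_eigenvalue x] *: ket (setbit anc true x).
Proof.
elim: D P Q => [|D IHD] P Q szP szQ PQ1.
  rewrite (size1_polyC szP) (size1_polyC szQ) in PQ1 *.
  have := PQ1 1 (normr1 _); rewrite !hornerC => /(implementable_rotation anc).
  case=> V impV Vket; exists V => // x x0.
  rewrite Vket /= (negbTE x0) !hornerC.
  by rewrite -{1}(negbTE x0) (setbit_id anc).
have ort : P`_0 * (P`_D.+1)^* + Q`_0 * (Q`_D.+1)^* = 0.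
  have : P * conj_rev D.+1 P + Q * conj_rev D.+1 Q = 'X^(D.+1).
    apply: poly_eq_on_circle => z z1; rewrite hornerD !hornerM hornerXn.
    rewrite !horner_conj_rev1 // -[RHS]mulr1 -(PQ1 z z1); ring.
  move/(congr1 (fun p : {poly C} => p`_0)).
  by rewrite coefD !coef0M !coef_poly subn0 coefXn.
have [c [s [cs1 sc0 csD]]] := unit_vector_along ort.
(* Undoing the rotation by [(c, s)] cancels the top coefficient of [P1] and the constant one of
   [Q1]. Hence [Q1] is divisible by ['X], a factor supplied by the controlled eigenvalue gate. *)
pose P1 := c^* *: P + s^* *: Q; pose Q1 := c *: Q - s *: P.
have szP1 : (size P1 <= D.+1)%N.
  apply/leq_sizeP => i; rewrite leq_eqVlt coefD !coefZ => /orP[/eqP <- //|lti].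
  by rewrite (leq_sizeP _ _ szP) // (leq_sizeP _ _ szQ) // !mulr0 addr0.
have /factor_theorem[Q2 eQ1] : root Q1 0.
  by rewrite rootE horner_coef0 coefB !coefZ sc0 subrr.
rewrite subr0 in eQ1.
have szQ2 : (size Q2 <= D.+1)%N.
  apply/leq_sizeP => i lei; have := coefMX Q2 i.+1; rewrite -eQ1 /= => <-.
  rewrite coefB !coefZ (leq_sizeP _ _ szP) //.
  by rewrite (leq_sizeP _ _ szQ) // !mulr0 subr0.
have Q2E z : z * Q2.[z] = c * Q.[z] - s * P.[z].
  have := congr1 (horner^~ z) eQ1.
  by rewrite /Q1 hornerD hornerN !hornerZ hornerM hornerX => ->; rewrite mulrC.
have [z z1|M impM Mket] := IHD P1 Q2 szP1 szQ2.
  have zz : z * z^* = 1 by rewrite -normCK z1 expr1n.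
  transitivity (P1.[z] * (P1.[z])^* + (z * Q2.[z]) * (z * Q2.[z])^*).
    by rewrite [(z * _)^*]rmorphM /= mulrACA zz mul1r.
  rewrite Q2E hornerD !hornerZ rmorphD rmorphB !rmorphM /= !conjCK.
  transitivity ((c * c^* + s * s^*) * (P.[z] * (P.[z])^* + Q.[z] * (Q.[z])^*)).
    by ring.
  by rewrite cs1 PQ1 // mulr1.
have [V impV Vket] := implementable_rotation anc cs1.
have [U impU Uket] := implementable_controlled_shift_eigenvalue.
exists (V *m (U *m M)) => [|x x0].
  rewrite (_ : D.+1 * n.+1 + 1 = D * n.+1 + 1 + n + 1)%N; last first.
    by rewrite mulSn; lia.
  exact: implementable_mul (implementable_mul impM impU) impV.
rewrite -!mulmxA Mket // !mulmxDr -!scalemxAr !Uket -!scalemxAr !Vket.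
rewrite (negbTE x0) /= !bitq_setbit eqxx !setbitK shift_eigenvalue_setbit scale1r.
have -> : setbit anc false x = x by rewrite -{1}(negbTE x0) (setbit_id anc).
rewrite scalerA (mulrC Q2.[_]) Q2E hornerD !hornerZ !scalerDr !scalerA.
rewrite addrACA -!scalerDl; set z := shift_eigenvalue x.
congr (_ *: _ + _ *: _).
  by rewrite -[RHS]mul1r -cs1; ring.
by rewrite -[RHS]mul1r -cs1; ring.
Qed.

End SignalProcessing.

(** * Block encoding of the convolution *)

(** Fejer-Riesz applied to ['X^D - P * conj_rev D P], which on the circle is [z ^+ D] times the
    positive function [1 - |P|^2]. *)
Lemma complementary_poly (C : numClosedFieldType) (D : nat) (P : {poly C}) :
    (size P <= D.+1)%N -> (forall z : C, `|z| = 1 -> `|P.[z]| < 1) ->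
  exists2 Q : {poly C}, (size Q <= D.+1)%N &
    forall z : C, `|z| = 1 -> P.[z] * (P.[z])^* + Q.[z] * (Q.[z])^* = 1.
Proof.
move=> szP ltP1; pose G := 'X^D - P * conj_rev D P.
have eqG z : `|z| = 1 -> G.[z] * z^-1 ^+ D = 1 - P.[z] * (P.[z])^*.
  move=> z1; have nz := norm1_neq0 z1.
  rewrite hornerD hornerN hornerM hornerXn horner_conj_rev1 // mulrCA.
  by rewrite -{1}[z ^+ D]mulr1 -mulrBr mulrAC -exprMn mulfV // expr1n mul1r.
have [||Q szQ eqQ] := @Fejer_Riesz C D G.
- rewrite (leq_trans (size_polyD _ _)) // geq_max size_polyXn size_polyN.
  rewrite ltnS -addnn leq_addr (leq_trans (size_polyMleq _ _)) //.
  have szR : (size (conj_rev D P) <= D.+1)%N by apply: size_poly.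
  by rewrite -subn1 leq_subLR (leq_trans (leq_add szP szR)) // addSn addnS.
- move=> z z1; rewrite eqG // -normCK subr_gt0.
  by rewrite expr_lt1 // ltP1.
exists Q => // z z1.
by rewrite -normCK -(normCK Q.[z]) -eqQ // eqG // -normCK addrC subrK.
Qed.

(** Modulo [2 ^ n], adding [2 ^ n - 1] subtracts 1, so the natural number [k + d * (2 ^ n - 1)]
    stands for the possibly negative shift [k - d]. *)
Lemma eq_addlow_conv (n d k : nat) (x y : 'I_(2 ^ n)) :
  (widen_ord (pow2_leS n) x
     == addlow n (k + d * (2 ^ n - 1)) (widen_ord (pow2_leS n) y)) =
  (((x%:Z - (k%:Z - d%:Z)) %% (2 ^ n)%:Z)%Z == y%:Z).
Proof.
rewrite -val_eqE /= val_addlow ?leqnSn //= divn_small // mul0n add0n.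
set N := (2 ^ n)%N; have N_gt0 : (0 < N)%N by rewrite expn_gt0.
rewrite -{1}(modn_small (ltn_ord x)) -[in RHS](modn_small (ltn_ord y)) -/N.
rewrite -!eqz_nat -!modz_nat !eqz_mod_dvd.
have -> : x%:Z - (k%:Z - d%:Z) - y%:Z =
    d%:Z * N%:Z + (x%:Z - (y + (k + d * (N - 1)))%N%:Z) :> int.
  by rewrite !PoszD PoszM -subzn //; ring.
by apply/esym/rpredDl; rewrite dvdz_mull.
Qed.

Lemma bitq_widen (n : nat) (x : 'I_(2 ^ n)) :
  bitq n (widen_ord (pow2_leS n) x) = false.
Proof. by rewrite /bitq /= divn_small. Qed.

Theorem theorem12 :
  exists c : nat,
  forall (R : realType) (n d : nat) (a : int -> R[i]),
    (0 < n)%N ->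
    exists gs : seq (gate R n.+1),
      all (@well_formed R n.+1) gs /\
      (size gs <= c * (d * n + n ^ 2))%N /\
      exists alpha : R, 0 < alpha /\
        anc0_block (circuit_mx gs) = real_complex R alpha^-1 *: conv_mx n d a.
Proof.
(* The circuit below has at most [2 * n ^ 2 + (2 * d * n.+1 + 1) + n] gates, and [0 < n] bounds this
   by [4 * (d * n + n ^ 2)]. *)
exists 4%N => R n d a n_gt0.
pose b (k : nat) : R[i] := a (k%:Z - d%:Z).
(* The summand 1 makes [|P| < 1] strict on the circle and keeps [N] positive for a zero filter. *)
pose N : R[i] := 1 + \sum_(k < (2 * d).+1) `|b k|.
have N_gt0 : 0 < N by rewrite ltr_pwDl // sumr_ge0.
pose P := \poly_(k < (2 * d).+1) (N^-1 * b k).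
have szP : (size P <= (2 * d).+1)%N by apply: size_poly.
have PE z : P.[z] = \sum_(k < (2 * d).+1) N^-1 * b k * z ^+ k.
  by rewrite horner_poly.
have [z z1|Q szQ PQ1] := complementary_poly szP.
  apply: (@le_lt_trans _ _ (N^-1 * \sum_(k < (2 * d).+1) `|b k|)).
    rewrite PE mulr_sumr; apply: le_trans (ler_norm_sum _ _ _) _.
    apply: ler_sum => k _; rewrite !normrM normrX z1 expr1n mulr1.
    by rewrite normfV (gtr0_norm N_gt0).
  by rewrite mulrC ltr_pdivrMr // mul1r ltrDr.
have [M impM Mket] := signal_processing n szP szQ PQ1.
have [F [F' [impF impF' FF FT Fq]]] := fourier_transform R (leqnSn n).
(* The shift eigenvalues are roots of unity of order dividing [2 ^ n], so the power [e] acts as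
   [- d] and removes the factor [z ^+ d] that made [P] a polynomial. *)
pose e := (d * (2 ^ n - 1))%N.
pose De := dg (fun x : 'I_(2 ^ n.+1) => shift_eigenvalue R x ^+ e).
have impD : implementable n De by apply: implementable_shift_eigenvalue_exp.
have [gs [wf sz gsE]] := implementable_mul
  (implementable_mul (implementable_mul impF impM) impD) impF'.
exists gs; split=> //; split.
  by apply: leq_trans sz _; nia.
exists (complex.Re N); have NE : real_complex R (complex.Re N) = N.
  by apply: RRe_real; rewrite gtr0_real.
split; first by rewrite -ltcR NE.
rewrite fmorphV /= NE {}gsE; apply/matrixP => x y.
set W := F' *m _.
(* [S] is the rescaled convolution on the low [n] qubits, [DS] its diagonal form, and [Pi] the
   projector onto ancilla 0. *)
pose S : 'M[R[i]]_(2 ^ n.+1) :=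
  \sum_(k < (2 * d).+1) (N^-1 * b k) *: shift_mx R n.+1 n (k + e).
pose DS : 'M[R[i]]_(2 ^ n.+1) := \sum_(k < (2 * d).+1)
  (N^-1 * b k) *: dg (fun x => shift_eigenvalue R x ^+ (k + e)).
pose Pi : 'M[R[i]]_(2 ^ n.+1) := dg (phase n 0).
have FS : F *m S = DS *m F.
  rewrite mulmx_sumr mulmx_suml; apply: eq_bigr => k _.
  rewrite -scalemxAr -scalemxAl FT; congr (_ *: (_ *m _)).
  by apply: eq_dg => z; rewrite shift_eigenvalue_exp.
have FPi : F *m Pi = Pi *m F by apply: Fq.
(* A one-sided inverse of a square matrix is two-sided, so [F'] inherits the commutation from
   [F]. *)
have F'Pi : F' *m Pi = Pi *m F'.
  rewrite -[LHS]mulmx1 -(mulmx1C FF) mulmxA.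
  by rewrite -(mulmxA F') -FPi mulmxA FF mul1mx.
(* Starting from ancilla 0, [M] leaves the [Q] component on ancilla 1, where the left [Pi] kills
   it. *)
have PiM : Pi *m (De *m (M *m Pi)) = DS *m Pi.
  apply: eq_mx_ket => z; rewrite -!mulmxA dg_ket /phase.
  case: ifP => z0; first by rewrite scale0r !mulmx0.
  rewrite scale1r Mket ?z0 // !mulmxDr -!scalemxAr !dg_ket -!scalemxAr !dg_ket.
  rewrite /phase z0 bitq_setbit eqxx scale0r !scaler0 addr0 scale1r scalerA.
  rewrite mulmx_suml PE mulr_suml scaler_suml; apply: eq_bigr => k _.
  by rewrite -scalemxAl dg_ket scalerA exprD mulrA.
have PiWPi : Pi *m (W *m Pi) = S *m Pi.
  rewrite /W -!mulmxA FPi (mulmxA Pi F') -F'Pi -!mulmxA.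
  rewrite (mulmxA M) (mulmxA De) (mulmxA Pi) PiM -mulmxA -FPi (mulmxA DS) -FS.
  by rewrite -!mulmxA mulmxA FF mul1mx.
(* At indices with ancilla bit 0 both projectors have diagonal entry 1, so they drop out of the
   entry. *)
have WS : W (widen_ord (pow2_leS n) x) (widen_ord (pow2_leS n) y) =
          S (widen_ord (pow2_leS n) x) (widen_ord (pow2_leS n) y).
  have := congr1 (fun A : 'M_(2 ^ n.+1) =>
    A (widen_ord (pow2_leS n) x) (widen_ord (pow2_leS n) y)) PiWPi.
  rewrite /Pi /dg mul_diag_mx !mul_mx_diag; clearbody W S.
  by rewrite !mxE /phase !bitq_widen mul1r !mulr1.
rewrite [LHS]mxE WS summxE !mxE mulr_sumr; apply: eq_bigr => k _.
rewrite !mxE eq_addlow_conv.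
by case: ifP; rewrite ?mulr1 ?mulr0.
Qed.
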